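(* Let $n,m\in\mathbb{N}$, $a\in\Delta_n$, $b\in\Delta_m$, $C\in\mathbb{R}^{n\times m}$, and let $\lambda_x,\lambda_y,\lambda>0$. Let $L_X\in\mathbb{R}^{n\times n}$ and $L_Y\in\mathbb{R}^{m\times m}$ be the unnormalized graph Laplacians of weighted graphs with vertex sets $[n]$ and $[m]$, and let $\pi^\star$ be the solution (unique minimizer) of the problem $\mathsf{LapOT}_{\lambda_x,\lambda_y,\lambda}(a,b,C,L_X,L_Y)$. Assume: (i) the graphs inducing $L_X$ and $L_Y$ have exactly $r$ and $s$ connected components, respectively, and $\{A_\alpha\}_{\alpha=1}^{r}$ and $\{B_\beta\}_{\beta=1}^{s}$ are the corresponding partitions of $[n]$ and $[m]$ into connected components; (ii) $a$ is constant on each $A_\alpha$ and $b$ is constant on each $B_\beta$. Let $L_X=\Phi_X\Lambda_X\Phi_X^\top$ and $L_Y=\Phi_Y\Lambda_Y\Phi_Y^\top$ be orthogonal eigendecompositions ($\Phi_X,\Phi_Y$ orthogonal), where $\Lambda_X,\Lambda_Y$ are diagonal with the eigenvalues $\mu_1^X\le\cdots\le\mu_n^X$ of $L_X$ and $\mu_1^Y\le\cdots\le\mu_m^Y$ of $L_Y$ in this order. For $\ell\in[n]$ and $h\in[m]$, let $P_{X,\ell}=\Phi_{X,\ell}\Phi_{X,\ell}^\top$ and $P_{Y,h}=\Phi_{Y,h}\Phi_{Y,h}^\top$, where $\Phi_{X,\ell}$ and $\Phi_{Y,h}$ consist of the first $\ell$ columns of $\Phi_X$ and the first $h$ columns of $\Phi_Y$,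 respectively. Then $P_{X,r}\pi^\star$ is obtained from $\pi^\star$ by averaging its rows over each block $A_\alpha$, i.e. $(P_{X,r}\pi^\star)_{ij}=\frac{1}{|A_\alpha|}\sum_{i'\in A_\alpha}\pi^\star_{i'j}$ for $i\in A_\alpha$, $j\in[m]$, and $\pi^\star P_{Y,s}$ is obtained by averaging its columns over each block $B_\beta$, i.e. $(\pi^\star P_{Y,s})_{ij}=\frac{1}{|B_\beta|}\sum_{j'\in B_\beta}\pi^\star_{ij'}$ for $i\in[n]$, $j\in B_\beta$. Moreover, $$\|\pi^\star-P_{X,r}\pi^\star\|_{\mathrm F}^2\le\frac{\|P_{X,r}C-C\|_\infty}{\lambda_x\,\mu_{r+1}^X}\quad(\text{if } r<n)\qquad\text{and}\qquad \|\pi^\star-\pi^\star P_{Y,s}\|_{\mathrm F}^2\le\frac{\|CP_{Y,s}-C\|_\infty}{\lambda_y\,\mu_{s+1}^Y}\quad(\text{if } s<m).$$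
   Context: Notation: $[n]=\{1,\dots,n\}$; $\Delta_n=\{a\in\mathbb{R}_{\ge0}^n:\sum_i a_i=1\}$; $1_n$ is the all-ones vector; $\Pi_{a,b}=\{P\in\mathbb{R}_{\ge0}^{n\times m}: P1_m=a,\ P^\top1_n=b\}$ is the set of couplings; $\langle A,B\rangle=\mathrm{tr}(A^\top B)$ with Frobenius norm $\|A\|_{\mathrm F}=\sqrt{\langle A,A\rangle}$; $\|A\|_\infty=\max_{i,j}|A_{ij}|$ (entrywise); $H(P)=-\sum_{i,j}P_{ij}(\log P_{ij}-1)$ for $P\in\mathbb{R}_{\ge0}^{n\times m}$, with the convention $0\log 0=0$. Graph Laplacian: a weighted graph on $[n]$ is given by a symmetric matrix $K\in\mathbb{R}^{n\times n}$ with nonnegative entries ($i,i'$ are adjacent iff $K_{ii'}>0$); its unnormalized graph Laplacian is $L=\mathrm{diag}(K1_n)-K$. LapOT: for $\lambda_x,\lambda_y,\lambda>0$, $\mathsf{LapOT}_{\lambda_x,\lambda_y,\lambda}(a,b,C,L_X,L_Y)$ is the problem $$\min_{\pi\in\Pi_{a,b}}\ \langle\pi,C\rangle+\lambda_x\langle\pi,L_X\pi\rangle+\lambda_y\langle\pi,\pi L_Y\rangle-\lambda H(\pi),$$ which has a unique minimizer by strict convexity. *)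

(* Defs.v *)
From HB Require Import structures.
From mathcomp Require Import all_boot all_order all_algebra.
From mathcomp Require Import reals exp normedtype.

Set Implicit Arguments.
Unset Strict Implicit.
Unset Printing Implicit Defensive.

Import Order.TTheory GRing.Theory Num.Theory.
Local Open Scope ring_scope.

Section OptimalTransport.
Variable R : realType.

Definition simplex n (a : 'cV[R]_n) : Prop :=
  (forall i, 0 <= a i 0) /\ \sum_i a i 0 = 1.

Definition coupling n m (a : 'cV[R]_n) (b : 'cV[R]_m) (P : 'M[R]_(n, m)) : Prop :=
  [/\ forall i j, 0 <= P i j,
      P *m const_mx 1 = a &
      P^T *m const_mx 1 = b].

Definition frob_inner n m (A B : 'M[R]_(n, m)) : R := \tr (A^T *m B).

Definition frob_norm n m (A : 'M[R]_(n, m)) : R := Num.sqrt (frob_inner A A).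

(* The convention 0 log 0 = 0 holds because [ln] is a total real function. *)
Definition entropy n m (P : 'M[R]_(n, m)) : R :=
  - \sum_i \sum_j P i j * (ln (P i j) - 1).

(* A weighted graph on 'I_n is given by its weight matrix; diagonal weights
   (self-loops) are allowed. *)
Definition weighted_graph n (K : 'M[R]_n) : Prop :=
  K^T = K /\ forall i j, 0 <= K i j.

Definition laplacian n (K : 'M[R]_n) : 'M[R]_n :=
  diag_mx (K *m const_mx 1 : 'cV[R]_n)^T - K.

Definition adjacent n (K : 'M[R]_n) : rel 'I_n := fun i j => 0 < K i j.

(* [connect] is the reflexive-transitive closure; it is an equivalence relation
   here since weight matrices are symmetric. *)
Definition components n (K : 'M[R]_n) : {set {set 'I_n}} :=
  equivalence_partition (connect (adjacent K)) [set: 'I_n].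

(* The family A lists every connected component exactly once; in particular
   there are exactly r of them. *)
Definition components_family n (K : 'M[R]_n) r (A : 'I_r -> {set 'I_n}) : Prop :=
  injective A /\ [set A alpha | alpha : 'I_r] = components K.

Definition lapot_obj n m (lx ly lam : R) (C : 'M[R]_(n, m))
    (LX : 'M[R]_n) (LY : 'M[R]_m) (P : 'M[R]_(n, m)) : R :=
  frob_inner P C + lx * frob_inner P (LX *m P)
    + ly * frob_inner P (P *m LY) - lam * entropy P.

Definition lapot_solution n m (lx ly lam : R) (a : 'cV[R]_n) (b : 'cV[R]_m)
    (C : 'M[R]_(n, m)) (LX : 'M[R]_n) (LY : 'M[R]_m) (P : 'M[R]_(n, m)) : Prop :=
  coupling a b P /\
  forall Q, coupling a b Q ->
    lapot_obj lx ly lam C LX LY P <= lapot_obj lx ly lam C LX LY Q.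

Definition orthogonal_mx n (Phi : 'M[R]_n) : Prop := Phi^T *m Phi = 1%:M.

(* mu 0 k is the (k+1)-th smallest eigenvalue, with multiplicity. *)
Definition ordered_eigendecomposition n (L Phi : 'M[R]_n) (mu : 'rV[R]_n) : Prop :=
  [/\ orthogonal_mx Phi,
      L = Phi *m diag_mx mu *m Phi^T &
      forall k k' : 'I_n, (k <= k')%N -> mu 0 k <= mu 0 k'].

(* The bound [minn l n] makes this total in l: for l <= n it is the matrix of
   the first l columns, otherwise the whole matrix. *)
Definition first_cols n (Phi : 'M[R]_n) (l : nat) : 'M[R]_(n, minn l n) :=
  colsub (widen_ord (geq_minr l n)) Phi.

Definition spectral_proj n (Phi : 'M[R]_n) (l : nat) : 'M[R]_n :=
  first_cols Phi l *m (first_cols Phi l)^T.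

End OptimalTransport.

(* Main.v *)
(* Let E be the matrix averaging over the components of the X-graph. It is the
   orthogonal projector on ker L_X: a vector killed by L_X is constant along
   edges since <v, L v> = 1/2 sum K_ik (v_i - v_k)^2. As tr E = r, exactly the r
   smallest eigenvalues vanish, so the spectral projector P_{X,r} equals E. Since
   E is doubly stochastic and fixes a, E pi is again a coupling. Comparing the
   objective at pi and E pi: the entropy does not decrease (Jensen), the Y-term
   does not increase (E is a projector and L_Y is positive semidefinite), and the
   X-term drops from <pi, L_X pi> >= mu_{r+1} |pi - E pi|^2 to 0. Optimality
   then gives lx mu_{r+1} |pi - E pi|^2 <= <pi, E C - C>, and pi has mass 1.
   The Y-side is the X-side of the transposed problem. *)
Require Import Defs.
From HB Require Import structures.
From mathcomp Require Import all_boot all_order all_algebra.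
From mathcomp Require Import reals exp normedtype.
From mathcomp Require Import ring lra.

Set Implicit Arguments.
Unset Strict Implicit.
Unset Printing Implicit Defensive.

Import Order.TTheory GRing.Theory Num.Theory.
Local Open Scope ring_scope.

(** * The Frobenius inner product and the entrywise maximum norm *)

Section FrobeniusInner.
Variable R : realType.

Lemma frob_innerE n m (A B : 'M[R]_(n, m)) :
  frob_inner A B = \sum_i \sum_j A i j * B i j.
Proof.
rewrite /frob_inner /mxtrace exchange_big /=; apply: eq_bigr => j _.
by rewrite mxE; apply: eq_bigr => i _; rewrite mxE.
Qed.

Lemma frob_norm_sqr n m (A : 'M[R]_(n, m)) : frob_norm A ^+ 2 = frob_inner A A.
Proof.
rewrite sqr_sqrtr // frob_innerE.
by apply: sumr_ge0 => i _; apply: sumr_ge0 => j _; rewrite -expr2 sqr_ge0.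
Qed.

Lemma frob_inner_tr n m (A B : 'M[R]_(n, m)) :
  frob_inner A^T B^T = frob_inner A B.
Proof.
rewrite !frob_innerE exchange_big /=.
by apply: eq_bigr => i _; apply: eq_bigr => j _; rewrite !mxE.
Qed.

Lemma frob_inner_mulmxl n m p (M : 'M[R]_(n, p)) (A : 'M[R]_(p, m)) B :
  frob_inner (M *m A) B = frob_inner A (M^T *m B).
Proof. by rewrite /frob_inner trmx_mul mulmxA. Qed.

Lemma frob_innerBr n m (A B C : 'M[R]_(n, m)) :
  frob_inner A (B - C) = frob_inner A B - frob_inner A C.
Proof. by rewrite /frob_inner mulmxBr raddfB. Qed.

Lemma frob_inner_diag n m (d : 'rV[R]_n) (X : 'M[R]_(n, m)) :
  frob_inner X (diag_mx d *m X) = \sum_i d 0 i * \sum_j X i j ^+ 2.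
Proof.
rewrite frob_innerE; apply: eq_bigr => i _; rewrite mulr_sumr.
by apply: eq_bigr => j _; rewrite mul_diag_mx mxE; ring.
Qed.

Lemma coord_le_mx_norm n m (A : 'M[R]_(n, m)) i j : `|A i j| <= mx_norm A.
Proof.
rewrite mx_normrE.
exact: (le_bigmax_cond _ (fun k => `|A k.1 k.2|) (j := (i, j))).
Qed.

End FrobeniusInner.

(** * Convexity of x (ln x - 1) and monotonicity of the entropy under averaging *)

Section Entropy.
Variable R : realType.

(** The left side is the tangent at y of the convex function x (ln x - 1), whose derivative is ln x.
    At x = 0 the claim reduces to -y <= 0; otherwise it is x times ln (y/x) <= y/x - 1. *)
Lemma xlnx_tangent (x y : R) : 0 <= x -> 0 < y ->
  y * (ln y - 1) + ln y * (x - y) <= x * (ln x - 1).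
Proof.
move=> x0 y0; have [->|xN0] := eqVneq x 0; first by rewrite mul0r; lra.
have {x0 xN0} x0 : 0 < x by rewrite lt_def xN0.
have yx0 : 0 < y / x by rewrite divr_gt0.
have /le_ln1Dx : -1 < y / x - 1 by lra.
have -> : 1 + (y / x - 1) = y / x by ring.
rewrite ln_div ?posrE // => /(ler_wpM2l (ltW x0)).
have -> : x * (y / x - 1) = y - x by field; rewrite gt_eqF.
by nra.
Qed.

Lemma xlnx_jensen n (w x : 'I_n -> R) :
  (forall i, 0 <= w i) -> \sum_i w i = 1 -> (forall i, 0 <= x i) ->
  (\sum_i w i * x i) * (ln (\sum_i w i * x i) - 1) <= \sum_i w i * (x i * (ln (x i) - 1)).
Proof.
move=> w0 w1 x0; have wx0 i : 0 <= w i * x i by rewrite mulr_ge0.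
have : 0 <= \sum_i w i * x i by rewrite sumr_ge0.
move ye : (\sum_i w i * x i) => y.
(* There is no tangent at mean 0; but then every w_i x_i is 0 and both sides vanish. *)
rewrite le_eqVlt => /predU1P[y0|y0].
  rewrite -y0 mul0r big1 // => i _; rewrite mulrA.
  by rewrite (psumr_eq0P (P := xpredT) (fun i _ => wx0 i) (etrans ye (esym y0))) ?mul0r.
(* Average the tangents at y: the slope terms cancel because y is the weighted mean. *)
apply: (@le_trans _ _ (\sum_i w i * (y * (ln y - 1) + ln y * (x i - y)))).
  have -> : \sum_i w i * (y * (ln y - 1) + ln y * (x i - y)) =
      (y * (ln y - 1) - ln y * y) * (\sum_i w i) +
      ln y * (\sum_i w i * x i).
    rewrite !mulr_sumr -big_split /=; apply: eq_bigr => i _; ring.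
  by rewrite w1 ye; lra.
by apply: ler_sum => i _; rewrite ler_wpM2l // xlnx_tangent.
Qed.

(** Row sums 1 allow Jensen at each entry of [E *m P]; column sums 1 turn the resulting double sum
    back into the entropy of [P]. *)
Lemma entropy_le_mulmx n m (E : 'M[R]_n) (P : 'M[R]_(n, m)) :
  (forall i k, 0 <= E i k) -> (forall i, \sum_k E i k = 1) ->
  (forall k, \sum_i E i k = 1) -> (forall i j, 0 <= P i j) ->
  entropy P <= entropy (E *m P).
Proof.
move=> E0 Er Ec P0; rewrite /entropy lerN2.
rewrite exchange_big [leRHS]exchange_big /=; apply: ler_sum => j _.
apply: (@le_trans _ _
  (\sum_i \sum_k E i k * (P k j * (ln (P k j) - 1)))).
  by apply: ler_sum => i _; rewrite mxE xlnx_jensen.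
rewrite exchange_big /=; apply: ler_sum => k _.
by rewrite -mulr_suml Ec mul1r.
Qed.

Lemma entropy_tr n m (P : 'M[R]_(n, m)) : entropy P^T = entropy P.
Proof.
rewrite /entropy exchange_big /=; congr (- _).
by apply: eq_bigr => i _; apply: eq_bigr => j _; rewrite mxE.
Qed.

End Entropy.

(** * Dirichlet energy, kernel of the Laplacian, and the averaging matrix *)

Section Laplacian.
Variables (R : realType) (n : nat) (K : 'M[R]_n).
Hypothesis hK : weighted_graph K.

Lemma weight_sym i k : K i k = K k i.
Proof. by case: hK => /matrixP /(_ k i); rewrite mxE. Qed.

Lemma laplacian_tr : (laplacian K)^T = laplacian K.
Proof. by rewrite /laplacian linearB /= tr_diag_mx hK.1. Qed.

Lemma laplacian_mulE m (P : 'M[R]_(n, m)) i j :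
  (laplacian K *m P) i j = \sum_k K i k * (P i j - P k j).
Proof.
rewrite mulmxBl mul_diag_mx !mxE.
under [RHS]eq_bigr do rewrite mulrBr.
rewrite sumrB mulr_suml; congr (_ - _).
by apply: eq_bigr => k _; rewrite mxE mulr1.
Qed.

(** This is the Dirichlet energy, doubled so that it can be symmetrized in i and k. *)
Lemma frob_inner_laplacian m (P : 'M[R]_(n, m)) :
  frob_inner P (laplacian K *m P) *+ 2 =
  \sum_i \sum_k K i k * \sum_j (P i j - P k j) ^+ 2.
Proof.
have e : frob_inner P (laplacian K *m P) =
    \sum_i \sum_k K i k * \sum_j P i j * (P i j - P k j).
  rewrite frob_innerE; apply: eq_bigr => i _.
  under [RHS]eq_bigr do rewrite mulr_sumr.
  rewrite exchange_big /=; apply: eq_bigr => j _.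
  rewrite laplacian_mulE mulr_sumr; apply: eq_bigr => k _; ring.
(* In the second copy i and k are swapped; since [K] is symmetric, the two products add up to a
   square. *)
rewrite mulr2n {1}e e [X in _ + X]exchange_big /= -big_split /=.
apply: eq_bigr => i _; rewrite -big_split /=; apply: eq_bigr => k _.
rewrite [K k i]weight_sym -mulrDr -big_split /=; congr (_ * _).
by apply: eq_bigr => j _; ring.
Qed.

Lemma laplacian_psd m (P : 'M[R]_(n, m)) :
  0 <= frob_inner P (laplacian K *m P).
Proof.
suff : 0 <= frob_inner P (laplacian K *m P) *+ 2 by rewrite pmulrn_lge0.
rewrite frob_inner_laplacian.
apply: sumr_ge0 => i _; apply: sumr_ge0 => k _; rewrite mulr_ge0 //.
  exact: hK.2.
by apply: sumr_ge0 => j _; apply: sqr_ge0.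
Qed.

(** Zero energy makes each nonnegative term vanish, so rows agree along edges; induction on a path
    does the rest. *)
Lemma laplacian_ker m (P : 'M[R]_(n, m)) i k j :
  laplacian K *m P = 0 -> connect (adjacent K) i k -> P i j = P k j.
Proof.
move=> LP0.
have s0 : \sum_i \sum_k K i k * \sum_j (P i j - P k j) ^+ 2 = 0.
  by rewrite -frob_inner_laplacian LP0 /frob_inner mulmx0 raddf0 mul0rn.
have q0 p q : 0 <= \sum_j (P p j - P q j) ^+ 2.
  by apply: sumr_ge0 => l _; apply: sqr_ge0.
have t0 p q : 0 <= K p q * \sum_j (P p j - P q j) ^+ 2.
  by rewrite mulr_ge0 // hK.2.
have adj p q : adjacent K p q -> P p j = P q j.
  rewrite /adjacent => Kpq.
  have h1 := psumr_eq0P (P := xpredT) (fun p _ => sumr_ge0 _ (fun q _ => t0 p q)) s0.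
  have /eqP := psumr_eq0P (P := xpredT) (fun q _ => t0 p q) (h1 p isT) (i := q) isT.
  rewrite mulf_eq0 gt_eqF //= => /eqP h2.
  have /eqP := psumr_eq0P (P := xpredT)
    (fun j _ => sqr_ge0 (P p j - P q j)) h2 (i := j) isT.
  by rewrite sqrf_eq0 subr_eq0 => /eqP.
case/connectP => p; elim: p i => [|q p IH] i /= => [_ ->//|/andP[iq qp] kl].
by rewrite (adj _ _ iq); apply: IH.
Qed.

(** The boolean in [*+] is read as 0 or 1, an indicator of lying in the same component. *)
Definition comp_avg : 'M[R]_n :=
  \matrix_(i, k) (#|connect (adjacent K) i|%:R^-1 *+ connect (adjacent K) i k).

Lemma adjacent_connect_sym : connect_sym (adjacent K).
Proof. by apply: sym_connect_sym => i k; rewrite /adjacent weight_sym. Qed.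

Lemma card_connect_same i k : connect (adjacent K) i k ->
  #|connect (adjacent K) i| = #|connect (adjacent K) k|.
Proof.
by move/(same_connect adjacent_connect_sym) => e; apply: eq_card => l; exact: e.
Qed.

Lemma card_connect_neq0 i : #|connect (adjacent K) i|%:R != 0 :> R.
Proof. by rewrite pnatr_eq0 -lt0n; apply/card_gt0P; exists i; apply: connect0. Qed.

Lemma comp_avg_mulE m (P : 'M[R]_(n, m)) i j :
  (comp_avg *m P) i j = #|connect (adjacent K) i|%:R^-1 *
    \sum_(k | connect (adjacent K) i k) P k j.
Proof.
rewrite mxE mulr_sumr [RHS]big_mkcond /=; apply: eq_bigr => k _.
by rewrite mxE; case: ifP => _; rewrite ?mulr1n ?mulr0n ?mul0r.
Qed.

Lemma comp_avg_const m (P : 'M[R]_(n, m)) :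
  (forall i k j, connect (adjacent K) i k -> P i j = P k j) -> comp_avg *m P = P.
Proof.
move=> cP; apply/matrixP => i j; rewrite comp_avg_mulE.
rewrite (eq_bigr (fun=> P i j)) => [|k ik]; last by rewrite (cP i k).
by rewrite sumr_const -[P i j *+ _]mulr_natl mulKf // card_connect_neq0.
Qed.

Lemma comp_avg_tr : comp_avg^T = comp_avg.
Proof.
apply/matrixP => i k; rewrite !mxE adjacent_connect_sym.
by case: (boolP (connect _ i k)) => [/card_connect_same->|]; rewrite ?mulr0n.
Qed.

(** The rows of the averaging matrix at adjacent vertices coincide, so every weighted difference is
    0. *)
Lemma laplacian_comp_avg : laplacian K *m comp_avg = 0.
Proof.
apply/matrixP => i j; rewrite laplacian_mulE [RHS]mxE big1 // => k _.
have := hK.2 i k; rewrite le_eqVlt => /predU1P[<-|Kik]; first by rewrite mul0r.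
have ik : connect (adjacent K) i k by apply: connect1.
rewrite !mxE (card_connect_same ik).
by rewrite (same_connect adjacent_connect_sym ik) subrr mulr0.
Qed.

Lemma comp_avg_laplacian : comp_avg *m laplacian K = 0.
Proof.
by rewrite -[LHS]trmxK trmx_mul comp_avg_tr laplacian_tr laplacian_comp_avg trmx0.
Qed.

Lemma comp_avg_ker m (P : 'M[R]_(n, m)) :
  laplacian K *m P = 0 -> comp_avg *m P = P.
Proof. by move=> LP; apply: comp_avg_const => i k j; apply: laplacian_ker. Qed.

Lemma comp_avg_idem : comp_avg *m comp_avg = comp_avg.
Proof. exact: comp_avg_ker laplacian_comp_avg. Qed.

Lemma comp_avg_const1 : comp_avg *m const_mx 1 = const_mx 1 :> 'cV[R]_n.
Proof. by apply: comp_avg_const => i k j _; rewrite !mxE. Qed.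

Lemma comp_avg_ge0 i k : 0 <= comp_avg i k.
Proof. by rewrite mxE mulrn_wge0 // invr_ge0 ler0n. Qed.

Lemma comp_avg_row i : \sum_k comp_avg i k = 1.
Proof.
have /matrixP/(_ i 0) := comp_avg_const1; rewrite [LHS]mxE [RHS]mxE => e; rewrite -[RHS]e.
by apply: eq_bigr => k _; rewrite [const_mx _ _ _]mxE mulr1.
Qed.

Lemma comp_avg_col k : \sum_i comp_avg i k = 1.
Proof.
rewrite -(comp_avg_row k); apply: eq_bigr => i _.
by rewrite -[in LHS]comp_avg_tr [LHS]mxE.
Qed.

Lemma connect_equiv : {in [set: 'I_n] & &, equivalence_rel (connect (adjacent K))}.
Proof.
move=> i k l _ _ _; split=> [|ik]; first exact: connect0.
exact: same_connect adjacent_connect_sym _ _ ik l.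
Qed.

Lemma mem_components S i : S \in components K -> i \in S ->
  S = [set k | connect (adjacent K) i k].
Proof.
case/imsetP => k _ -> {S}; rewrite !inE => ki.
by apply/setP => l; rewrite !inE (same_connect adjacent_connect_sym ki).
Qed.

(** A component S contributes |S| diagonal entries equal to 1/|S|, hence 1 in total. *)
Lemma trace_comp_avg : \tr comp_avg = #|components K|%:R.
Proof.
rewrite /mxtrace (eq_bigl (mem [set: 'I_n])) => [|i]; last by rewrite /= in_setT.
rewrite (set_partition_big _ (equivalence_partitionP connect_equiv)) /=.
rewrite -sumr_const; apply: eq_bigr => S SK.
have /card_gt0P[i iS] : (0 < #|S|)%N.
  rewrite card_gt0; apply/eqP => S0; move: SK; rewrite S0 => h.
  by have := equivalence_partitionP connect_equiv; case/and3P => _ _; rewrite h.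
rewrite (eq_bigr (fun=> #|S|%:R^-1)) => [|k kS].
  rewrite sumr_const -[_^-1 *+ _]mulr_natl divff // pnatr_eq0 -lt0n.
  by apply/card_gt0P; exists i.
by rewrite mxE connect0 (mem_components SK kS) cardsE.
Qed.

End Laplacian.

(** * Zero eigenvalues, the spectral projector and the spectral gap *)

Section SpectralProjection.
Variables (R : realType) (n : nat).

Lemma mul_mx_col m p (M : 'M[R]_(m, n)) (N : 'M[R]_(n, p)) k :
  col k (M *m N) = M *m col k N.
Proof. by rewrite !colE mulmxA. Qed.

(** Writing the projector with a 0/1 diagonal keeps all matrices n by n, which removes the truncated
    dimension [minn l n]. *)
Lemma spectral_projE (Phi : 'M[R]_n) l :
  spectral_proj Phi l =
  Phi *m diag_mx (\row_k (k < l)%:R) *m Phi^T.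
Proof.
apply/matrixP => i j; rewrite [RHS]mxE.
rewrite (bigID (fun k : 'I_n => k < minn l n)%N) /= [X in _ + X]big1 ?addr0.
  rewrite (big_ord_narrow (geq_minr l n)) /= mxE; apply: eq_bigr => k _.
  by rewrite mul_mx_diag !mxE /= (leq_trans (ltn_ord k)) ?geq_minl // mulr1.
move=> k; rewrite mul_mx_diag !mxE leq_min ltn_ord andbT => /negbTE->.
by rewrite mulr0 mul0r.
Qed.

Section Laplacian.
Variables (K Phi : 'M[R]_n) (mu : 'rV[R]_n).
Hypotheses (hK : weighted_graph K)
  (hPhi : ordered_eigendecomposition (laplacian K) Phi mu).

Let PhiTPhi : Phi^T *m Phi = 1%:M. Proof. by case: hPhi. Qed.
Let PhiPhiT : Phi *m Phi^T = 1%:M. Proof. exact: mulmx1C. Qed.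
Let LE : laplacian K = Phi *m diag_mx mu *m Phi^T. Proof. by case: hPhi. Qed.

Let LPhi : laplacian K *m Phi = Phi *m diag_mx mu.
Proof. by rewrite LE -mulmxA PhiTPhi mulmx1. Qed.

Lemma frob_inner_laplacian_eigen m (P : 'M[R]_(n, m)) :
  frob_inner P (laplacian K *m P) =
  \sum_k mu 0 k * \sum_j (Phi^T *m P) k j ^+ 2.
Proof.
rewrite -frob_inner_diag frob_inner_mulmxl trmxK LE.
by rewrite !mulmxA.
Qed.

Lemma eigenvalue_ge0 k : 0 <= mu 0 k.
Proof.
(* The energy of the k-th eigenvector is its eigenvalue. *)
have := laplacian_psd hK (col k Phi).
rewrite frob_inner_laplacian_eigen -mul_mx_col PhiTPhi (bigD1 k) //=.
rewrite [X in _ + X]big1.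
  by rewrite big_ord1 !mxE eqxx expr1n mulr1 addr0.
by move=> l lk; rewrite big_ord1 !mxE (negbTE lk) expr0n mulr0.
Qed.

(** Check on each eigenvector v_k: it is fixed if mu_k = 0, and otherwise v_k = mu_k^-1 L v_k is
    killed because E L = 0. *)
Lemma comp_avg_eigenE :
  comp_avg K = Phi *m diag_mx (\row_k (mu 0 k == 0)%:R) *m Phi^T.
Proof.
suff <- : comp_avg K *m Phi = Phi *m diag_mx (\row_k (mu 0 k == 0)%:R).
  by rewrite -mulmxA PhiPhiT mulmx1.
have Lcol k : laplacian K *m col k Phi = mu 0 k *: col k Phi.
  rewrite -mul_mx_col LPhi; apply/matrixP => i j.
  by rewrite mxE mul_mx_diag !mxE mulrC.
apply/matrixP => i k; rewrite mul_mx_diag [RHS]mxE [X in _ * X]mxE.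
have -> : (comp_avg K *m Phi) i k = (comp_avg K *m col k Phi) i 0.
  by rewrite -mul_mx_col [RHS]mxE.
have [muk0|muk0] := eqVneq (mu 0 k) 0.
  by rewrite comp_avg_ker // ?Lcol ?muk0 ?scale0r // mxE mulr1.
have -> : col k Phi = (mu 0 k)^-1 *: (laplacian K *m col k Phi).
  by rewrite Lcol scalerA mulVf // scale1r.
by rewrite -scalemxAr mulmxA comp_avg_laplacian // mul0mx scaler0 mxE mulr0.
Qed.

(** Both numbers are the trace of [comp_avg K]. *)
Lemma card_eigenvalue0 : #|[pred k | mu 0 k == 0]| = #|components K|.
Proof.
apply/eqP; rewrite -(eqr_nat R) -trace_comp_avg // comp_avg_eigenE.
rewrite mxtrace_mulC mulmxA PhiTPhi mul1mx mxtrace_diag -sum1_card natr_sum.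
rewrite big_mkcond /=; apply/eqP/eq_bigr => k _.
by rewrite mxE inE; case: eqP.
Qed.

(** Ordered nonnegative eigenvalues vanish on a downward closed set of indices, which its
    cardinality then determines. Indices start at 0, hence the strict inequality. *)
Lemma eigenvalue_eq0 k : (mu 0 k == 0) = (k < #|components K|)%N.
Proof.
rewrite -card_eigenvalue0; set Z := [pred k | _].
have Zdown (i j : 'I_n) : (i <= j)%N -> Z j -> Z i.
  move=> ij /eqP muj; rewrite /= eq_le eigenvalue_ge0 andbT -muj.
  by case: hPhi => _ _; apply.
have card_lt (j : nat) : (j <= n)%N -> #|[pred i : 'I_n | (i < j)%N]| = j.
  move=> jn; rewrite -sum1_card (eq_bigl (fun i : 'I_n => (i < j)%N)) //.
  by rewrite (big_ord_narrow jn) sum1_card card_ord.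
apply/idP/idP => [Zk|].
  rewrite -[leqLHS](card_lt k.+1) //; apply/subset_leq_card/subsetP => i.
  by rewrite inE ltnS => ik; exact: Zdown ik Zk.
(* If k is outside the set, all its members lie below k, so it has at most k elements. *)
apply: contraTT => Zk; rewrite -leqNgt.
rewrite -[leqRHS](card_lt k (ltnW (ltn_ord k))); apply/subset_leq_card/subsetP => i Zi.
by rewrite inE ltnNge; apply: contra Zk => ki; exact: Zdown ki Zi.
Qed.

Lemma spectral_proj_components :
  spectral_proj Phi #|components K| = comp_avg K.
Proof.
rewrite spectral_projE comp_avg_eigenE; congr (_ *m diag_mx _ *m _).
by apply/rowP => k; rewrite !mxE eigenvalue_eq0.
Qed.

(** In eigencoordinates P - E P keeps exactly the indices k >= r, where mu_k is at least the entry
    at [Ordinal hr], that is mu_{r+1} counted from 1. The other coordinates only add nonnegative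
    energy. *)
Lemma spectral_gap m (P : 'M[R]_(n, m)) (hr : (#|components K| < n)%N) :
  mu 0 (Ordinal hr) * frob_norm (P - comp_avg K *m P) ^+ 2 <=
  frob_inner P (laplacian K *m P).
Proof.
set r := #|components K| in hr *.
have -> : P - comp_avg K *m P =
    Phi *m (diag_mx (\row_k (r <= k)%:R) *m (Phi^T *m P)).
  have -> : diag_mx (\row_k (r <= k)%:R) =
      1%:M - diag_mx (\row_k (k < r)%:R) :> 'M[R]_n.
    apply/matrixP => i j; rewrite !mxE -mulrnBl leqNgt.
    by case: (i < r)%N; case: (i == j); rewrite ?subrr ?subr0 ?mul0rn.
  rewrite mulmxBl mulmxBr mul1mx !mulmxA PhiPhiT mul1mx.
  by rewrite -spectral_projE spectral_proj_components.
rewrite frob_norm_sqr frob_inner_mulmxl [Phi^T *m (Phi *m _)]mulmxA PhiTPhi mul1mx.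
rewrite frob_inner_laplacian_eigen frob_innerE mulr_sumr.
apply: ler_sum => k _; rewrite !mulr_sumr.
apply: ler_sum => j _; rewrite mul_diag_mx.
set X := (Phi^T *m P) k j; have X2 := sqr_ge0 X.
rewrite mxE [(\row__ _) _ _]mxE -/X; case: (leqP r k) => rk /=.
  have : mu 0 (Ordinal hr) <= mu 0 k by case: hPhi => _ _; apply.
  by move/(ler_wpM2r X2); lra.
by have := mulr_ge0 (eigenvalue_ge0 k) X2; lra.
Qed.

End Laplacian.
End SpectralProjection.

(** * Transposition symmetry, the averaged competitor and the error bound *)

Section Bound.
Variable R : realType.

Lemma lapot_obj_tr n m lx ly lam (C : 'M[R]_(n, m)) KX KY P :
  weighted_graph KX -> weighted_graph KY ->
  lapot_obj ly lx lam C^T (laplacian KY) (laplacian KX) P^T =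
  lapot_obj lx ly lam C (laplacian KX) (laplacian KY) P.
Proof.
move=> hX hY; rewrite /lapot_obj entropy_tr frob_inner_tr.
rewrite -{1}(laplacian_tr hY) -{1}(laplacian_tr hX) -!trmx_mul !frob_inner_tr.
by rewrite [_ + ly * _ + _]addrAC.
Qed.

Lemma coupling_tr n m (a : 'cV[R]_n) (b : 'cV[R]_m) P :
  coupling a b P -> coupling b a P^T.
Proof. by case=> P0 Pa Pb; split; rewrite ?trmxK // => i j; rewrite mxE. Qed.

Lemma lapot_solution_tr n m lx ly lam (a : 'cV[R]_n) (b : 'cV[R]_m) C KX KY P :
  weighted_graph KX -> weighted_graph KY ->
  lapot_solution lx ly lam a b C (laplacian KX) (laplacian KY) P ->
  lapot_solution ly lx lam b a C^T (laplacian KY) (laplacian KX) P^T.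
Proof.
move=> hX hY [Pab Pmin]; split=> [|Q Qba]; first exact: coupling_tr.
by rewrite -[Q]trmxK !lapot_obj_tr //; apply: Pmin; apply: coupling_tr.
Qed.

(** The row marginal survives because E a = a, the column marginal because E is symmetric and fixes
    the all-ones vector. *)
Lemma coupling_comp_avg n m (K : 'M[R]_n) (a : 'cV[R]_n) (b : 'cV[R]_m) P :
  weighted_graph K ->
  (forall i k, connect (adjacent K) i k -> a i 0 = a k 0) ->
  coupling a b P -> coupling a b (comp_avg K *m P).
Proof.
move=> hK ca [P0 Pa Pb]; split.
- move=> i j; rewrite mxE sumr_ge0 // => k _.
  by rewrite mulr_ge0 // comp_avg_ge0.
- rewrite -mulmxA Pa comp_avg_const // => i k j.
  by rewrite ord1; exact: ca.
- by rewrite trmx_mul comp_avg_tr // -mulmxA comp_avg_const1.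
Qed.

Lemma coupling_mass n m (a : 'cV[R]_n) (b : 'cV[R]_m) P :
  simplex a -> coupling a b P -> \sum_i \sum_j P i j = 1.
Proof.
move=> [_ <-] [_ Pa _]; apply: eq_bigr => i _; rewrite -Pa mxE.
by apply: eq_bigr => j _; rewrite mxE mulr1.
Qed.

Lemma frob_inner_le_norm n m (P D : 'M[R]_(n, m)) (c : R) :
  (forall i j, 0 <= P i j) -> (forall i j, `|D i j| <= c) ->
  frob_inner P D <= (\sum_i \sum_j P i j) * c.
Proof.
move=> P0 Dc; rewrite frob_innerE mulr_suml; apply: ler_sum => i _.
rewrite mulr_suml; apply: ler_sum => j _.
by rewrite ler_wpM2l // (le_trans (ler_norm _)).
Qed.

(* Replacing [P] by its row average decreases this term by
   [frob_inner D (D *m laplacian K)] where [D := P - E *m P]. *)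
Lemma frob_inner_mulmxr_avg n m (E : 'M[R]_n) (K : 'M[R]_m) (P : 'M[R]_(n, m)) :
  weighted_graph K -> E^T = E -> E *m E = E ->
  frob_inner (E *m P) (E *m P *m laplacian K) <=
  frob_inner P (P *m laplacian K).
Proof.
move=> hK Et EE; have := laplacian_psd hK (P - E *m P)^T.
rewrite -[_ *m _^T]trmxK trmx_mul trmxK laplacian_tr // frob_inner_tr.
set F := 1%:M - E; have -> : P - E *m P = F *m P by rewrite mulmxBl mul1mx.
have FF : F^T *m F = F.
  have -> : F^T = F by rewrite /F raddfB /= trmx1 Et.
  by rewrite /F mulmxBl mul1mx mulmxBr mulmx1 EE subrr subr0.
rewrite frob_inner_mulmxl -(mulmxA F) (mulmxA F^T) FF mulmxBl mul1mx.
by rewrite frob_innerBr subr_ge0 frob_inner_mulmxl Et -(mulmxA E) (mulmxA E E) EE.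
Qed.

(** A free entrywise bound [c] in place of [mx_norm] lets the transposed problem use the norm of the
    untransposed matrix directly. *)
Lemma lapot_comp_avg_bound n m (a : 'cV[R]_n) (b : 'cV[R]_m) C lx ly lam KX KY
    (pi : 'M[R]_(n, m)) (Phi : 'M[R]_n) (mu : 'rV[R]_n) (c : R)
    (hr : (#|components KX| < n)%N) :
  simplex a -> 0 < lx -> 0 < ly -> 0 < lam ->
  weighted_graph KX -> weighted_graph KY ->
  lapot_solution lx ly lam a b C (laplacian KX) (laplacian KY) pi ->
  (forall i k, connect (adjacent KX) i k -> a i 0 = a k 0) ->
  ordered_eigendecomposition (laplacian KX) Phi mu ->
  (forall i j, `|(comp_avg KX *m C - C) i j| <= c) ->
  frob_norm (pi - comp_avg KX *m pi) ^+ 2 <= c / (lx * mu 0 (Ordinal hr)).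
Proof.
move=> ha lx0 ly0 lam0 hX hY [piab pimin] ca hPhi hc.
(* Position r, counted from 0, is the first one past the zero eigenvalues. *)
have mu0 : 0 < mu 0 (Ordinal hr).
  by rewrite lt_def (eigenvalue_ge0 hX hPhi) (eigenvalue_eq0 hX hPhi) ltnn.
rewrite ler_pdivlMr ?mulr_gt0 // mulrC -mulrA.
have [pi0 _ _] := piab.
have gap := ler_wpM2l (ltW lx0) (spectral_gap hX hPhi pi hr).
apply: (le_trans gap).
have hE := frob_inner_le_norm pi0 hc.
rewrite (coupling_mass ha piab) mul1r in hE; apply: le_trans hE.
(* Test optimality against the averaged plan; its X-term is 0 because L E = 0, and symmetry of E
   moves the averaging onto [C]. *)
have := pimin _ (coupling_comp_avg hX ca piab).
rewrite /lapot_obj [laplacian KX *m (_ *m _)]mulmxA laplacian_comp_avg // mul0mx.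
rewrite [frob_inner (comp_avg KX *m pi) 0]/frob_inner mulmx0 raddf0 mulr0.
rewrite [frob_inner (comp_avg KX *m pi) C]frob_inner_mulmxl comp_avg_tr //.
rewrite frob_innerBr.
have := ler_wpM2l (ltW ly0)
  (frob_inner_mulmxr_avg pi hY (comp_avg_tr hX) (comp_avg_idem hX)).
have := ler_wpM2l (ltW lam0) (entropy_le_mulmx (comp_avg_ge0 KX)
  (comp_avg_row KX) (comp_avg_col hX) pi0).
lra.
Qed.

(** This translates the indexed family into connectivity; injectivity makes the number of indices
    the number of components. *)
Lemma components_family_connect n (K : 'M[R]_n) r (A : 'I_r -> {set 'I_n}) :
  weighted_graph K -> components_family K A ->
  [/\ #|components K| = r,
      forall alpha i, i \in A alpha ->
        A alpha = [set k | connect (adjacent K) i k] &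
      forall i, exists alpha, i \in A alpha].
Proof.
move=> hK [Ainj AK]; split.
- by rewrite -AK card_imset // card_ord.
- by move=> alpha i; apply: mem_components => //; rewrite -AK imset_f.
move=> i.
have : [set k | connect (adjacent K) i k] \in components K.
  by apply/imsetP; exists i => //; apply/setP => k; rewrite !inE.
by rewrite -AK => /imsetP[alpha _ e]; exists alpha; rewrite -e inE connect0.
Qed.

Lemma components_family_const n (K : 'M[R]_n) r (A : 'I_r -> {set 'I_n})
    (a : 'cV[R]_n) :
  weighted_graph K -> components_family K A ->
  (forall alpha, {in A alpha &, forall i i', a i 0 = a i' 0}) ->
  forall i k, connect (adjacent K) i k -> a i 0 = a k 0.
Proof.
move=> hK /(components_family_connect hK)[_ AE Acov] ca i k ik.
have [alpha iA] := Acov i; apply: (ca alpha) => //.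
by rewrite (AE _ _ iA) inE.
Qed.

Lemma comp_avg_family n m (K : 'M[R]_n) r (A : 'I_r -> {set 'I_n})
    (P : 'M[R]_(n, m)) alpha i j :
  weighted_graph K -> components_family K A -> i \in A alpha ->
  (comp_avg K *m P) i j = #|A alpha|%:R^-1 * \sum_(k in A alpha) P k j.
Proof.
move=> hK /(components_family_connect hK)[_ AE _] iA.
rewrite comp_avg_mulE (AE _ _ iA) cardsE; congr (_ * _).
by apply: eq_bigl => k; rewrite inE.
Qed.

End Bound.

(** * Assembly of the two sides *)

Theorem theorem1 (R : realType) (n m : nat) (a : 'cV[R]_n) (b : 'cV[R]_m)
    (C : 'M[R]_(n, m)) (lx ly lam : R)
    (KX : 'M[R]_n) (KY : 'M[R]_m) (pi : 'M[R]_(n, m))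
    (r s : nat) (A : 'I_r -> {set 'I_n}) (B : 'I_s -> {set 'I_m})
    (PhiX : 'M[R]_n) (muX : 'rV[R]_n) (PhiY : 'M[R]_m) (muY : 'rV[R]_m) :
  simplex a -> simplex b ->
  0 < lx -> 0 < ly -> 0 < lam ->
  weighted_graph KX -> weighted_graph KY ->
  lapot_solution lx ly lam a b C (laplacian KX) (laplacian KY) pi ->
  components_family KX A -> components_family KY B ->
  (forall alpha, {in A alpha &, forall i i', a i 0 = a i' 0}) ->
  (forall beta, {in B beta &, forall j j', b j 0 = b j' 0}) ->
  ordered_eigendecomposition (laplacian KX) PhiX muX ->
  ordered_eigendecomposition (laplacian KY) PhiY muY ->
  let PX := spectral_proj PhiX r in
  let PY := spectral_proj PhiY s in
  [/\ forall (alpha : 'I_r) (i : 'I_n) (j : 'I_m), i \in A alpha ->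
        (PX *m pi) i j = #|A alpha|%:R^-1 * \sum_(i' in A alpha) pi i' j,
      forall (beta : 'I_s) (i : 'I_n) (j : 'I_m), j \in B beta ->
        (pi *m PY) i j = #|B beta|%:R^-1 * \sum_(j' in B beta) pi i j',
      forall hr : (r < n)%N,
        frob_norm (pi - PX *m pi) ^+ 2
          <= mx_norm (PX *m C - C) / (lx * muX 0 (Ordinal hr)) &
      forall hs : (s < m)%N,
        frob_norm (pi - pi *m PY) ^+ 2
          <= mx_norm (C *m PY - C) / (ly * muY 0 (Ordinal hs))].
Proof.
move=> ha hb lx0 ly0 lam0 hX hY sol hA hB ca cb eX eY /=.
have [rE _ _] := components_family_connect hX hA.
have [sE _ _] := components_family_connect hY hB.
have -> : spectral_proj PhiX r = comp_avg KX.
  by rewrite -rE (spectral_proj_components hX eX).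
have -> : spectral_proj PhiY s = comp_avg KY.
  by rewrite -sE (spectral_proj_components hY eY).
have trY (P : 'M[R]_(n, m)) : (P *m comp_avg KY)^T = comp_avg KY *m P^T.
  by rewrite trmx_mul comp_avg_tr.
split.
- by move=> alpha i j; apply: comp_avg_family.
- move=> beta i j jB; have -> : (pi *m comp_avg KY) i j = (pi *m comp_avg KY)^T j i.
    by rewrite [RHS]mxE.
  rewrite trY (comp_avg_family _ _ hY hB jB).
  by congr (_ * _); apply: eq_bigr => k _; rewrite mxE.
(* Replacing [r] by the number of components, with all that depends on it, makes [hr] index the same
   eigenvalue as in the bound. *)
- case: r / rE A hA ca => A hA ca hr.
  apply: (lapot_comp_avg_bound hr ha lx0 ly0 lam0 hX hY sol _ eX).
    exact: components_family_const hX hA ca.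
  exact: coord_le_mx_norm.
- case: s / sE B hB cb => B hB cb hs.
  (* The Frobenius norm is invariant under transposition, which turns column averaging of [pi] into
     row averaging of its transpose. *)
  rewrite frob_norm_sqr -frob_inner_tr -frob_norm_sqr linearB /= trY.
  apply: (lapot_comp_avg_bound hs hb ly0 lx0 lam0 hY hX
    (lapot_solution_tr hX hY sol) _ eY).
    exact: components_family_const hY hB cb.
  by move=> j i; rewrite -trY -linearB mxE coord_le_mx_norm.
Qed.
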